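(* For every positive integer $k$, the polynomial $\Delta_{3k,3}(c)$ is irreducible over $\mathbb{Q}$.
   Context: Let $f_c(z)=z^2+c\in\mathbb{Z}[c][z]$, and define iterates by $f_c^{\circ 0}(z)=z$, $f_c^{\circ j}=f_c\circ f_c^{\circ(j-1)}$. For $n\ge1$ the $n$-th dynatomic polynomial is $\Phi_n^*(z,c)=\prod_{j\mid n}(f_c^{\circ j}(z)-z)^{\mu(n/j)}$ ($\mu$ the Möbius function). The $n$-th multiplier polynomial $\delta_n(x,c)\in\mathbb{Z}[x,c]$ is the polynomial, monic in $x$, with $\delta_n(x,c)^n=\operatorname{Res}_z\big(\Phi_n^*(z,c),\,x-(f_c^{\circ n})'(z)\big)$. Let $\Psi_j(x)$ denote the $j$-th cyclotomic polynomial. For positive integers $m\mid n$ with $m<n$, the delta factor is $\Delta_{n,m}(c)=\operatorname{Res}_x(\Psi_{n/m}(x),\delta_m(x,c))$; and $\Delta_{n,n}(c)$ is defined by $\delta_n(1,c)=\Delta_{n,n}(c)\prod_{m\mid n,\,m\neq n}\Delta_{n,m}(c)$. *)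

(* Defs.v *)
From HB Require Import structures.
From mathcomp Require Import all_boot all_order all_algebra.
From mathcomp Require Import cyclotomic.
From Stdlib Require Import ClassicalEpsilon.
Set Implicit Arguments.
Unset Strict Implicit.
Unset Printing Implicit Defensive.
Import Order.TTheory GRing.Theory Num.Theory.
Local Open Scope ring_scope.

(* Polynomial rings used:
     Zc   := {poly int}        -- Z[c]
     Zcx  := {poly {poly int}} -- Z[c][x]  (outer variable x)  (or Z[c][z])
     Zcxz := {poly Zcx}        -- Z[c][x][z] (outer variable z) *)
Notation Zc := {poly int}.
Notation Zcx := {poly {poly int}}.
Notation Zcxz := {poly {poly {poly int}}}.

(* Standard (Sylvester) resultant: MathComp's [resultant] uses a Sylvester
   matrix with rows/columns ordered so that it equals
   (-1)^(deg p * deg q) times the classical resultant; we correct the sign so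
   that Res(p, q) = lc(p)^(deg q) * prod_{p(a)=0} q(a). *)
Definition Res (R : comNzRingType) (p q : {poly R}) : R :=
  (-1) ^+ ((size p).-1 * (size q).-1) * resultant p q.

Definition moebius (n : nat) : int :=
  if n == 0%N then 0
  else if all (fun p => logn p n == 1%N) (primes n)
       then (-1) ^+ size (primes n) else 0.

Definition cpar : Zcx := (('X : Zc))%:P.

Definition fiter (j : nat) : Zcx := iter j (fun p => p ^+ 2 + cpar) 'X.

(* n-th dynatomic polynomial Phi_n^*(z,c) in Z[c][z].  The division is an
   exact division by a monic polynomial (the Moebius product is a polynomial). *)
Definition dynatomic (n : nat) : Zcx :=
  (\prod_(j <- divisors n | moebius (n %/ j) == 1) (fiter j - 'X)) %/
  (\prod_(j <- divisors n | moebius (n %/ j) == -1) (fiter j - 'X)).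

(* Res_z(Phi_n^*(z,c), x - (f_c^{o n})'(z)) in Z[c][x] *)
Definition multres (n : nat) : Zcx :=
  Res (map_poly (@polyC Zc) (dynatomic n))
      ((('X : Zcx))%:P - map_poly (@polyC Zc) ((fiter n)^`())).

Definition is_multiplier_poly (n : nat) (P : Zcx) : Prop :=
  P \is monic /\ P ^+ n = multres n.

Definition delta (n : nat) : Zcx :=
  epsilon (inhabits 0) (is_multiplier_poly n).

Definition DeltaLt (n m : nat) : Zc :=
  Res (map_poly (@polyC int) 'Phi_(n %/ m)) (delta m).

Definition is_Delta_nn (n : nat) (D : Zc) : Prop :=
  (delta n).[1] = D * \prod_(m <- divisors n | m != n) DeltaLt n m.

Definition Delta (n m : nat) : Zc :=
  if (m < n)%N then DeltaLt n m
  else if m == n then epsilon (inhabits 0) (is_Delta_nn n)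
  else 0.

(* Main.v *)
Require Import Defs.
From HB Require Import structures.
From mathcomp Require Import all_boot all_order all_algebra.
From mathcomp Require Import cyclotomic.
From mathcomp Require Import fingroup all_field integral_char.
From mathcomp Require Import zify ring lra.
From Stdlib Require Import ClassicalEpsilon.
Import Order.TTheory GRing.Theory Num.Theory.
Set Implicit Arguments.
Unset Strict Implicit.
Unset Printing Implicit Defensive.
Local Open Scope ring_scope.

(* The curve delta_3(x, c) = 0 is rational: with c = -(7 + u^2)/4 one has
   delta_3(x, c) = (x - g(u)) (x - g(-u)) for g(u) = u^3 - u^2 + 7u + 1.  For
   k > 1, Delta_{3k,3} is the product over the primitive k-th roots of unity w
   of the cubics delta_3(w, c), so it is enough that delta_3(w, c) has no root
   in Q(w), i.e. that g(u) = w has no solution u in Q(w): the cubics are then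
   irreducible, distinct and permuted transitively by the Galois group.

   Let g(u) = w with u in Q(w), and put q = u^2 - u + 7, so that u q = w - 1.
   The norm of w - 1 is 1 or a prime, so u or q is a unit, and therefore
   A = q / q^* and B = u^* / u are algebraic integers; all their conjugates
   have absolute value 1.  Eliminating u^* gives u M = -7 (A - 1) with
   M = (A B^2 - 1) u - (A B - 1).  If A <> 1, then s = (A - 1) / u is a nonzero
   algebraic integer and M = -7 s, so M^3 q has norm at least 343^phi(k); but
   |M^3 q| <= (2|u| + 2)^3 |q| < 343 at every complex place.  If A = 1, the
   elimination leaves two explicit cases, each producing a nonzero algebraic
   integer all of whose conjugates are smaller than 1. *)

(** * Resultants as products over roots *)

Section ProductFormula.
Variable R : comNzRingType.
Implicit Types (p q : {poly R}) (a : R).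

Definition sylvester_row n p q (i : nat) : {poly R} :=
  if (i < n)%N then p * 'X^i else q * 'X^(i - n).

(** The dimensions are parameters rather than degrees, so that roots of [p] can be removed one by
    one with [n] fixed and [q] of any degree at most [n]. *)
Definition sylvester d n p q : 'M[R]_d :=
  \matrix_(i, j) (sylvester_row n p q i)`_j.

Lemma coef_mul_XsubC a p k :
  (('X - a%:P) * p)`_k = (if k is k'.+1 then p`_k' else 0) - a * p`_k.
Proof. by rewrite mulrBl coefB coefXM coefCM; case: k. Qed.

(* Both sides of [L *m sylvester = Z *m E] encode, row by row, the Sylvester
   rows with the rows X^j q (j > 0) replaced by X^(j-1) (X - a) q; on the right
   they are expanded in the basis 1, X - a, X (X - a), X^2 (X - a), ... *)
Lemma det_sylvester_XsubC d n a p q :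
  (size p <= (d - n).+1)%N -> (size q <= n.+1)%N -> (n <= d)%N ->
  \det (sylvester d.+1 n (('X - a%:P) * p) q) =
  (-1) ^+ n * q.[a] * \det (sylvester d n p q).
Proof.
move=> sp sq nd.
have [q1 Dq] : exists q1, q = ('X - a%:P) * q1 + (q.[a])%:P.
  have /factor_theorem[q1 e] : root (q - (q.[a])%:P) a.
    by rewrite /root hornerD hornerN hornerC subrr.
  by exists q1; rewrite mulrC -e subrK.
have sq1 : (size q1 <= n)%N.
  have [->|q10] := eqVneq q1 0; first by rewrite size_poly0.
  have -> : size q1 = (size (('X - a%:P) * q1)).-1.
    by rewrite mulrC size_Mmonic ?monicXsubC // size_XsubC addn2.
  have -> : ('X - a%:P) * q1 = q - (q.[a])%:P by rewrite {1}Dq addrK.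
  suff : (size (q - (q.[a])%:P)%R <= n.+1)%N by case: (size _).
  apply: leq_trans (size_polyD _ _) _; rewrite size_polyN geq_max sq.
  exact: leq_trans (size_polyC_leq1 _) _.
pose r i := if (i < n)%N then p * 'X^i else if i == n then q1 else q * 'X^(i - n.+1).
have sr i : (i < d.+1)%N -> (size (r i) <= d)%N.
  rewrite /r => id; case: ltnP => h1; last case: eqP => h2.
  - apply: leq_trans (size_polyMleq _ _) _; rewrite size_polyXn; lia.
  - exact: leq_trans sq1 nd.
  - apply: leq_trans (size_polyMleq _ _) _; rewrite size_polyXn; lia.
pose L : 'M[R]_d.+1 := \matrix_(i, j)
  ((i == j)%:R - a * ((n < i)%N && (i == j.+1 :> nat))%:R).
pose E : 'M[R]_d.+1 := \matrix_(i, j)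
  ((i == j)%:R - a * (i == j.+1 :> nat)%:R).
pose Z : 'M[R]_d.+1 := \matrix_(i, j)
  (if (j : nat) is j'.+1 then (r i)`_j' else if i == n :> nat then q.[a] else 0).
have detL : \det L = 1.
  rewrite det_trig; last first.
    apply/is_trig_mxP => i j ij; rewrite mxE.
    have -> : (i == j) = false by apply/negbTE; rewrite neq_ltn ij.
    have -> : (i == j.+1 :> nat) = false by apply/negbTE; lia.
    by rewrite andbF mulr0 subrr.
  rewrite big1 // => i _; rewrite mxE eqxx.
  have -> : (i == i.+1 :> nat) = false by lia.
  by rewrite andbF mulr0 subr0.
have detE : \det E = 1.
  rewrite det_trig; last first.
    apply/is_trig_mxP => i j ij; rewrite mxE.
    have -> : (i == j) = false by apply/negbTE; rewrite neq_ltn ij.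
    have -> : (i == j.+1 :> nat) = false by apply/negbTE; lia.
    by rewrite mulr0 subrr.
  rewrite big1 // => i _; rewrite mxE eqxx.
  have -> : (i == i.+1 :> nat) = false by lia.
  by rewrite mulr0 subr0.
have detZ : \det Z = (-1) ^+ n * q.[a] * \det (sylvester d n p q).
  have nd1 : (n < d.+1)%N by [].
  (* Only row [n] has a nonzero entry in column 0, namely [q.[a]]; its position gives the sign. *)
  rewrite (expand_det_col _ ord0) (bigD1 (Ordinal nd1)) //= big1 ?addr0 => [|i ni].
    rewrite mxE /= eqxx /cofactor /= addn0 mulrCA mulrA; congr (_ * _ * \det _).
    apply/matrixP => i j; rewrite !mxE lift0 /= /bump /r /sylvester_row.
    have [h|h] := leqP n i.
      rewrite add1n; have -> : (i.+1 < n)%N = false by lia.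
      have -> : (i.+1 == n) = false by lia.
      by rewrite ?subSS.
    by rewrite add0n h.
  rewrite mxE /=; case: eqP => [e|]; last by rewrite mul0r.
  by case/eqP: ni; apply: val_inj.
suff e : L *m sylvester d.+1 n (('X - a%:P) * p) q = Z *m E.
  by rewrite -detZ -[LHS]mul1r -detL -det_mulmx e det_mulmx detE mulr1.
apply/matrixP => i k.
transitivity ((('X - a%:P) * r i + (if i == n :> nat then (q.[a])%:P else 0))`_k).
- rewrite mxE.
  have -> : \sum_j L i j * sylvester d.+1 n (('X - a%:P) * p) q j k =
     (sylvester_row n (('X - a%:P) * p) q i)`_k -
     a * (if (n < i)%N then (sylvester_row n (('X - a%:P) * p) q i.-1)`_k else 0).
    rewrite (eq_bigr (fun j : 'I_d.+1 =>
       (sylvester_row n (('X - a%:P) * p) q j)`_k * (i == j)%:R -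
      a * ((sylvester_row n (('X - a%:P) * p) q j)`_k *
       ((n < i)%N && (i == j.+1 :> nat))%:R))); last first.
      by move=> j _; rewrite !mxE; ring.
    rewrite big_split /= sumrN -mulr_sumr; congr (_ - a * _).
      rewrite (bigD1 i) //= eqxx mulr1 big1 ?addr0 // => j /negbTE.
      by rewrite eq_sym => ->; rewrite mulr0.
    case: ltnP => ni /=; last by apply: big1 => j _; rewrite mulr0.
    have id : (i.-1 < d.+1)%N by move: (ltn_ord i); lia.
    rewrite (bigD1 (Ordinal id)) //= big1 ?addr0 => [|j].
      by rewrite prednK ?eqxx ?mulr1 //; lia.
    move=> /eqP hj; case: eqP => [e|]; last by rewrite mulr0.
    by case: hj; apply: val_inj; rewrite /= e.
  rewrite /r /sylvester_row.
  case: (ltngtP i n) => h.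
  + by rewrite mulr0 subr0 addr0 -mulrA.
  + have h1 : (i.-1 < n)%N = false by lia.
    rewrite h1 addr0 -coefCM -coefB; congr ((_ : {poly R})`_k).
    have -> : (i - n = (i - n.+1).+1)%N by lia.
    have -> : (i.-1 - n = i - n.+1)%N by lia.
    by rewrite exprS; ring.
  + by rewrite h subnn mulr1 mulr0 subr0 -Dq.
rewrite coefD coef_mul_XsubC mxE.
rewrite (eq_bigr (fun j : 'I_d.+1 => Z i j * (j == k)%:R -
    a * (Z i j * (j == k.+1 :> nat)%:R))); last by move=> j _; rewrite !mxE; ring.
rewrite big_split /= sumrN -mulr_sumr.
have -> : \sum_(j < d.+1) Z i j * (j == k)%:R = Z i k.
  rewrite (bigD1 k) //= eqxx mulr1 big1 ?addr0 // => j /negbTE ->.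
  by rewrite mulr0.
have -> : \sum_(j < d.+1) Z i j * (j == k.+1 :> nat)%:R = (r i)`_k.
  (* In the last column the shifted index falls outside the matrix; there the coefficient vanishes
     by the size bound on [r i]. *)
  have [kd|kd] := ltnP k.+1 d.+1.
    rewrite (bigD1 (Ordinal kd)) //= eqxx mulr1 big1 ?addr0 => [|j].
      by rewrite mxE.
    move=> /eqP hj; case: eqP => [e|]; last by rewrite mulr0.
    by case: hj; apply: val_inj.
  rewrite nth_default; last by apply: leq_trans (sr _ (ltn_ord i)) _; lia.
  apply: big1 => j _; have -> : (j == k.+1 :> nat) = false by move: (ltn_ord j); lia.
  by rewrite mulr0.
rewrite mxE; case: (k : nat) => [|k'] /=.
  by case: eqP => _; rewrite ?coefC ?coef0 /=; ring.
by case: eqP => _; rewrite ?coefC ?coef0 /=; ring.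
Qed.

Lemma det_sylvester_prod (s : seq R) n q : (size q <= n.+1)%N ->
  \det (sylvester (n + size s) n (\prod_(a <- s) ('X - a%:P)) q) =
  (-1) ^+ (size s * n) * \prod_(a <- s) q.[a].
Proof.
move=> sq; elim: s => [|a s IH].
  rewrite !big_nil /= addn0 mul0n expr0 mul1r.
  suff -> : sylvester n n 1 q = 1%:M by rewrite det1.
  apply/matrixP => i j; rewrite !mxE /sylvester_row ltn_ord mul1r coefXn.
  by rewrite eq_sym.
rewrite !big_cons /= addnS det_sylvester_XsubC ?leq_addr //.
  by rewrite IH mulSn exprD; ring.
by rewrite size_prod_XsubC; lia.
Qed.

Lemma Res_prod_XsubC (s : seq R) q :
  Res (\prod_(a <- s) ('X - a%:P)) q = \prod_(a <- s) q.[a].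
Proof.
set p := \prod_(a <- s) _.
have sp : (size p).-1 = size s by rewrite size_prod_XsubC.
have e : resultant p q =
    \det (sylvester ((size q).-1 + (size p).-1) (size q).-1 p q).
  congr (\det _); apply/matrixP => i j.
  rewrite Sylvester_mxE mxE /sylvester_row; case: split_ordP => k -> /=.
    by rewrite coefMXn; case: leqP => h; rewrite ?mulr1n ?mulr0n.
  rewrite addKn coefMXn.
  by case: leqP => h; rewrite ?mulr1n ?mulr0n.
rewrite /Res e sp det_sylvester_prod; last exact: leqSpred.
(* The sign built into [Res] cancels the one from the determinant. *)
by rewrite mulrA -exprD addnn -mul2n exprM sqrrN !expr1n mul1r.
Qed.

End ProductFormula.

(** * Multiplier polynomials of periods 1 and 3 *)

(** Nonvanishing leading coefficients preserve both degrees, hence the shape of the Sylvester matrix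
    and the sign in [Res]. *)
Lemma map_Res (aR rR : comNzRingType) (f : {rmorphism {poly aR} -> rR})
    (p q : {poly {poly aR}}) :
  f (lead_coef p) != 0 -> f (lead_coef q) != 0 ->
  f (Res p q) = Res (map_poly f p) (map_poly f q).
Proof.
move=> fp fq; rewrite /Res rmorphM rmorphXn rmorphN rmorph1 map_resultant //.
by rewrite !size_map_poly_id0.
Qed.

(** In p^n - q^n = (p - q) S, the cofactor S is a sum of n monic terms of equal degree, so its
    leading coefficient n keeps it from vanishing. *)
Lemma monic_expr_inj (R : idomainType) n (p q : {poly R}) : (0 < n)%N ->
  n%:R != 0 :> R -> p \is monic -> q \is monic -> p ^+ n = q ^+ n -> p = q.
Proof.
move=> n0 nR mp mq e.
have sp := size_exp p n; have sq := size_exp q n.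
have {sp sq}spq : ((size p).-1 = (size q).-1)%N.
  by apply/eqP; rewrite -(eqn_pmul2r n0) -sp -sq e.
set d := (size p).-1 in spq.
have/eqP := subrXX p q n; rewrite e subrr eq_sym mulf_eq0 => /orP[|/eqP h].
  by rewrite subr_eq0 => /eqP.
case/eqP: nR; have := congr1 (fun r : {poly R} => r`_(d * n.-1)) h.
rewrite coef_sum coef0 (eq_bigr (fun=> 1)) => [|i _].
  by rewrite sumr_const card_ord.
have mm : p ^+ (n.-1 - i) * q ^+ i \is monic by rewrite rpredM ?rpredX.
rewrite -[RHS](monicP mm) /lead_coef size_monicM ?monic_exp ?monic_neq0 ?monic_exp //.
congr (_`_ _).
have s0 (r : {poly R}) m : r \is monic -> size (r ^+ m) = ((size r).-1 * m).+1.
  move=> mr; rewrite -size_exp prednK // size_poly_gt0 monic_neq0 ?monic_exp //.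
rewrite !s0 // addSn addnS /= -spq -/d -mulnDr subnK //.
by have := ltn_ord i; lia.
Qed.

(** Uniqueness of monic n-th roots lets an explicit candidate replace the choice made by
    [epsilon]. *)
Lemma multiplier_poly_uniq n P : (0 < n)%N -> is_multiplier_poly n P ->
  delta n = P.
Proof.
move=> n0 HP; have [mon_d d_n] : is_multiplier_poly n (delta n).
  by rewrite /delta; apply: epsilon_spec; exists P.
case: HP => mon_P P_n; apply: (monic_expr_inj n0) => //; last by rewrite d_n P_n.
by rewrite -!polyC_natr !polyC_eq0 pnatr_eq0 -lt0n.
Qed.

Definition eval_c (c : algC) : {rmorphism {poly int} -> algC} :=
  horner_eval c \o map_poly (intr : int -> algC).

Lemma eval_cX c : eval_c c 'X = c.
Proof. by rewrite /eval_c /= map_polyX /horner_eval hornerX. Qed.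

(** The difference vanishes at more natural numbers than its degree allows. *)
Lemma eval_c_inj (p q : {poly int}) : (forall c, eval_c c p = eval_c c q) -> p = q.
Proof.
move=> e; apply: (map_inj_poly (@intr_inj algC)); rewrite ?rmorph0 //.
set d := map_poly intr p - map_poly intr q : {poly algC}.
suff /eqP : d = 0 by rewrite subr_eq0 => /eqP.
apply: (@roots_geq_poly_eq0 _ _ [seq i%:R | i <- iota 0 (size d)]).
- apply/allP => _ /mapP[i _ ->]; rewrite /root /d hornerD hornerN.
  by have := e i%:R; rewrite /eval_c /= /horner_eval => ->; rewrite subrr.
- rewrite map_inj_uniq ?iota_uniq // => i j /eqP.
  by rewrite eqr_nat => /eqP.
- by rewrite size_map size_iota.
Qed.

(** This is (x - 2a)(x - 2(1 - a)) for the fixed points a and 1 - a, where c = a - a^2. *)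
Definition delta1_poly : Zcx := 'X ^+ 2 - 2 * 'X + 4 * cpar.

(** The constant coefficient is 64 times the product of the six roots of [dynatomic3]. *)
Definition delta3_poly : Zcx := 'X ^+ 2 - (8 * cpar + 16) * 'X +
  64 * (cpar ^+ 3 + 2 * cpar ^+ 2 + cpar + 1).

Lemma monic_addC (R : nzRingType) (p : {poly R}) c : p \is monic ->
  (1 < size p)%N -> p + c%:P \is monic /\ size (p + c%:P) = size p.
Proof.
move=> mp sp; have lt_c : (size c%:P < size p)%N.
  exact: leq_ltn_trans (size_polyC_leq1 c) sp.
by rewrite monicE lead_coefDl // size_polyDl // (monicP mp) eqxx.
Qed.

Lemma monic_MXaddC (R : nzRingType) (p : {poly R}) c : p \is monic ->
  p * 'X + c%:P \is monic /\ size (p * 'X + c%:P) = (size p).+1.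
Proof.
move=> mp; have p0 := monic_neq0 mp.
rewrite -size_mulX //; apply: monic_addC; first by rewrite rpredM ?monicX.
by rewrite size_mulX // ltnS size_poly_gt0.
Qed.

Definition dynatomic3 : Zcx := let c := cpar in
  'X ^+ 6 + 'X ^+ 5 + (3 * c + 1) * 'X ^+ 4 + (2 * c + 1) * 'X ^+ 3 +
  (3 * c ^+ 2 + 3 * c + 1) * 'X ^+ 2 + (c ^+ 2 + 2 * c + 1) * 'X +
  (c ^+ 3 + 2 * c ^+ 2 + c + 1).

Lemma fiter1E : fiter 1 - 'X = ('X - 1%:P) * 'X + cpar.
Proof. by rewrite /fiter /=; ring. Qed.

Lemma dynatomic_1E : dynatomic 1 = fiter 1 - 'X.
Proof.
rewrite /dynatomic; have -> : divisors 1 = [:: 1%N] by [].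
by rewrite !big_cons !big_nil /= mulr1 divp1.
Qed.

Lemma dynatomic_3E : dynatomic 3 = dynatomic3.
Proof.
rewrite /dynatomic; have -> : divisors 3 = [:: 1%N; 3] by [].
rewrite !big_cons !big_nil /= !mulr1.
have -> : fiter 3 - 'X = dynatomic3 * (fiter 1 - 'X).
  by rewrite /fiter /dynatomic3 /=; ring.
rewrite fiter1E Pdiv.IdomainMonic.mulpK //.
exact: (monic_MXaddC 'X (monicXsubC (1 : {poly int}))).1.
Qed.

(* The 3-cycles of z^2 + c have a sum s with s^2 + s + c + 2 = 0, so s is a
   parameter for c; the points of the cycle are the roots of [cycle_cubic s], the
   other cycle belongs to the parameter -1-s, and u = -(2s + 1). *)
Definition cycle_cubic (s : algC) : {poly algC} :=
  let c := - (s ^+ 2 + s + 2) in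
  'X^3 - s%:P * 'X^2 + (c - 1 - s)%:P * 'X - (1 + c + c * s)%:P.

Lemma map_cpar c : map_poly (eval_c c) cpar = c%:P.
Proof. by rewrite /cpar map_polyC; congr _%:P; apply: eval_cX. Qed.

(** The six roots sum to -1, which is why the second cycle has parameter -1 - s. *)
Lemma map_dynatomic3 s : let c := - (s ^+ 2 + s + 2) in
  map_poly (eval_c c) dynatomic3 = cycle_cubic s * cycle_cubic (- 1 - s).
Proof.
move=> c; rewrite /dynatomic3 /cycle_cubic -/c.
have -> : - ((- 1 - s) ^+ 2 + (- 1 - s) + 2) = c by rewrite /c; ring.
have Dc : c%:P = - (s%:P ^+ 2 + s%:P + 2) :> {poly algC}.
  by rewrite /c polyCN polyCD (polyCD (s ^+ 2)) polyC_exp polyC_natr.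
clearbody c; rewrite !(rmorphD, rmorphM, rmorphXn, rmorph1, rmorph_nat) /= map_polyX.
rewrite !map_cpar !(polyCD, polyCN, polyCM, polyC1) Dc.
by ring.
Qed.

(** By the chain rule, the derivative of the third iterate is 8 z f(z) f(f(z)); this is its monic
    factor. *)
Definition fiter3_deriv : Zcx := let c := cpar in
  'X * ('X^2 + c) * (('X^2 + c) ^+ 2 + c).

Lemma fiter3_derivE : (fiter 3)^`() = 8 * fiter3_deriv.
Proof.
rewrite /fiter /fiter3_deriv /= !(derivD, derivX, deriv_exp) /= /cpar derivC.
by ring.
Qed.

Lemma horner_cycle_cubic s z : let c := - (s ^+ 2 + s + 2) in
  (cycle_cubic s).[z] =
  z ^+ 3 - s * z ^+ 2 + (c - 1 - s) * z - (1 + c + c * s).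
Proof.
move=> c; rewrite /cycle_cubic -/c; clearbody c.
by rewrite !(hornerC, hornerX, hornerXn, hornerN, hornerM, hornerD).
Qed.

Lemma horner_fiter3_deriv c z : (map_poly (eval_c c) fiter3_deriv).[z] =
  z * (z ^+ 2 + c) * ((z ^+ 2 + c) ^+ 2 + c).
Proof.
rewrite /fiter3_deriv !(rmorphXn, rmorphD, rmorphM) /= map_polyX map_cpar.
by rewrite !(hornerC, hornerX, horner_exp, hornerD, hornerM).
Qed.

(** Modulo the cubic, z f(z) f(f(z)) reduces to the product 1 + c + cs of the three roots, so the
    whole cycle has one multiplier. *)
Lemma cycle_cubic_multiplier s z : let c := - (s ^+ 2 + s + 2) in
  root (cycle_cubic s) z ->
  8 * (map_poly (eval_c c) fiter3_deriv).[z] = 8 * (1 + c + c * s).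
Proof.
move=> c /eqP; rewrite horner_cycle_cubic horner_fiter3_deriv -/c => e.
apply/eqP; rewrite -subr_eq0; apply/eqP.
(* the quotient of the difference by [cycle_cubic s] *)
rewrite -[RHS](mulr0 (8 * (z ^+ 4 + s * z ^+ 3 - (s ^+ 2 + s + 3) * z ^+ 2
  - (s ^+ 3 + s ^+ 2 + 3 * s + 1) * z + 1))) -e /c.
by ring.
Qed.

Lemma cycle_cubic_factor s : exists r : seq algC,
  size r = 3 /\ cycle_cubic s = \prod_(a <- r) ('X - a%:P).
Proof.
have [mon sz] : cycle_cubic s \is monic /\ size (cycle_cubic s) = 4.
  rewrite /cycle_cubic /=; set b := _ - 1 - s; set d := 1 + _ + _.
  have [mq sq] := monic_MXaddC b (monicXsubC s).
  have -> : 'X^3 - s%:P * 'X^2 + b%:P * 'X - d%:P =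
      (('X - s%:P) * 'X + b%:P) * 'X + (- d)%:P by rewrite polyCN; ring.
  have [mc sc] := monic_MXaddC (- d) mq.
  by rewrite sc sq size_XsubC.
have [r Dr] := closed_field_poly_normal (cycle_cubic s).
exists r; rewrite (monicP mon) scale1r in Dr; split=> //.
by apply/eqP; rewrite -eqSS -[X in X == _](size_prod_XsubC r id) -Dr sz.
Qed.

Lemma fiter3_deriv_monic : fiter3_deriv \is monic /\ (1 < size fiter3_deriv)%N.
Proof.
have mC : 'X^2 + cpar \is monic /\ size ('X^2 + cpar) = 3.
  by have := monic_addC 'X (monicXn {poly int} 2); rewrite size_polyXn; apply.
have mC2 : ('X^2 + cpar) ^+ 2 + cpar \is monic.
  have sz : (1 < size (('X^2 + cpar) ^+ 2))%N.
    rewrite size_monicM ?mC.1 ?monic_neq0 ?mC.1 // mC.2 //.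
  by have [] := monic_addC 'X (rpredX 2 mC.1) sz.
have mD : fiter3_deriv \is monic by rewrite !rpredM ?monicX ?mC.1.
split=> //; rewrite /fiter3_deriv -mulrA mulrC size_mulX.
  by rewrite ltnS size_poly_gt0 mulf_neq0 ?monic_neq0 ?mC.1.
by rewrite mulf_neq0 ?monic_neq0 ?mC.1.
Qed.

Lemma map_poly_polyC (R S : nzRingType) (f : {rmorphism R -> S}) (p : {poly R}) :
  map_poly (map_poly f) (map_poly polyC p) = map_poly polyC (map_poly f p).
Proof.
by rewrite -!map_poly_comp; apply: eq_map_poly => a /=; rewrite map_polyC.
Qed.

Lemma map_delta3_poly s : let c := - (s ^+ 2 + s + 2) in
  map_poly (eval_c c) delta3_poly =
  ('X - (8 * (1 + c + c * s))%:P) * ('X - (8 * (1 + c + c * (- 1 - s)))%:P).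
Proof.
move=> c; rewrite /delta3_poly.
have Dc : c%:P = - (s%:P ^+ 2 + s%:P + 2) :> {poly algC}.
  by rewrite /c polyCN polyCD (polyCD (s ^+ 2)) polyC_exp polyC_natr.
clearbody c; rewrite !(rmorphXn, rmorph1, rmorph_nat, rmorphD, rmorphN, rmorphM) /=.
rewrite map_polyX map_cpar Dc.
by ring.
Qed.

(** Once c is a number, the product formula turns the resultant into a product over the roots of the
    dynatomic polynomial. As F is monic of positive degree, no degree drops under specialisation. *)
Lemma multres_eval n (F : Zcx) d c (r : seq algC) : F \is monic ->
  (1 < size F)%N -> (0 < d)%N -> (fiter n)^`() = d%:R * F ->
  dynatomic n \is monic ->
  map_poly (eval_c c) (dynatomic n) = \prod_(a <- r) ('X - a%:P) ->
  map_poly (eval_c c) (multres n) =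
  \prod_(a <- r) ('X - (d%:R * (map_poly (eval_c c) F).[a])%:P).
Proof.
move=> mF sF d0 DF mD rD; rewrite /multres DF.
set q := ('X)%:P - _.
have Dq : map_poly polyC (d%:R * F) = d%:R * map_poly polyC F :> Zcxz.
  by rewrite rmorphM rmorph_nat.
have lead_q : lead_coef q = - d%:R.
  rewrite /q Dq addrC lead_coefDl; last first.
    rewrite size_polyN size_polyC polyX_eq0 -polyC_natr mul_polyC.
    by rewrite size_scale ?size_map_polyC // -polyC_natr polyC_eq0 -polyC_natr
      polyC_eq0 pnatr_eq0 -lt0n.
  rewrite lead_coefN -polyC_natr mul_polyC lead_coefZ lead_coef_map_inj //.
    by rewrite (monicP mF) polyC1 mulr1.
  exact: polyC_inj.
have Dd : map_poly (map_poly (eval_c c)) (map_poly polyC (dynatomic n)) =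
    \prod_(a <- [seq polyC a | a <- r]) ('X - a%:P).
  rewrite map_poly_polyC rD rmorph_prod big_map.
  by apply: eq_bigr => a _ /=; rewrite map_polyXsubC.
rewrite map_Res; last 2 first.
- rewrite lead_coef_map_inj ?(monicP mD) ?polyC1 ?rmorph1 ?oner_eq0 //.
  exact: polyC_inj.
- by rewrite lead_q rmorphN rmorph_nat oppr_eq0 -polyC_natr polyC_eq0 pnatr_eq0 -lt0n.
rewrite Dd Res_prod_XsubC big_map; apply: eq_bigr => a _.
have -> : map_poly (map_poly (eval_c c)) q =
    ('X)%:P - d%:R * map_poly polyC (map_poly (eval_c c) F).
  rewrite /q Dq rmorphB [in X in _ - X]rmorphM rmorph_nat -map_poly_polyC.
  by rewrite /= map_polyC /= map_polyX.
rewrite hornerD hornerN hornerC -polyC_natr hornerM hornerC horner_map.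
by rewrite polyCM polyC_natr.
Qed.

Lemma dynatomic3_monic : dynatomic3 \is monic.
Proof.
pose C : {poly int} := 'X.
have -> : dynatomic3 = ((((('X - (-1)%:P) * 'X + (3 * C + 1)%:P) * 'X +
    (2 * C + 1)%:P) * 'X + (3 * C ^+ 2 + 3 * C + 1)%:P) * 'X +
    (C ^+ 2 + 2 * C + 1)%:P) * 'X + (C ^+ 3 + 2 * C ^+ 2 + C + 1)%:P.
  rewrite /dynatomic3 /cpar -/C.
  by rewrite !(polyCN, polyC_exp, polyCM, polyCD, polyC1); ring.
by do 5!apply: (monic_MXaddC _ _).1; exact: monicXsubC.
Qed.

(** The three points of a cycle share a multiplier, so each cycle contributes the cube of a linear
    factor. *)
Lemma multres3_eval s : let c := - (s ^+ 2 + s + 2) in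
  map_poly (eval_c c) (multres 3) = map_poly (eval_c c) delta3_poly ^+ 3.
Proof.
move=> c; rewrite map_delta3_poly -/c.
have [mF sF] := fiter3_deriv_monic.
have [r [sr Dr]] := cycle_cubic_factor s.
have [r' [sr' Dr']] := cycle_cubic_factor (- 1 - s).
rewrite (@multres_eval 3 fiter3_deriv 8 c (r ++ r')) ?fiter3_derivE //; first last.
- by rewrite dynatomic_3E map_dynatomic3 Dr Dr' big_cat.
- by rewrite dynatomic_3E dynatomic3_monic.
have prod_r t (l : seq algC) : c = - (t ^+ 2 + t + 2) -> size l = 3 ->
    cycle_cubic t = \prod_(a <- l) ('X - a%:P) ->
    \prod_(a <- l) ('X - (8 * (map_poly (eval_c c) fiter3_deriv).[a])%:P) =
    ('X - (8 * (1 + c + c * t))%:P) ^+ 3.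
  move=> ct sl Dl; rewrite big_seq (eq_bigr (fun=> 'X - (8 * (1 + c + c * t))%:P)).
    by rewrite -big_seq big_const_seq count_predT sl /= !exprS expr0.
  move=> a al; rewrite ct cycle_cubic_multiplier // Dl.
  by rewrite root_prod_XsubC.
rewrite big_cat /= (prod_r s) // (prod_r (- 1 - s)) ?exprMn //.
by rewrite /c; ring.
Qed.

(** This allows identities over Z[c] to be checked after a substitution c = T(s) under which the
    dynatomic polynomial factors. *)
Lemma eval_c_poly_inj (T : algC -> algC) (P Q : Zcx) :
  (forall c, exists s, c = T s) ->
  (forall s, map_poly (eval_c (T s)) P = map_poly (eval_c (T s)) Q) -> P = Q.
Proof.
move=> surjT e; apply/polyP => i; apply: eval_c_inj => c.
have [s ->] := surjT c.
by have := congr1 (fun p : {poly algC} => p`_i) (e s); rewrite !coef_map.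
Qed.

Lemma complex_quadratic (a b : algC) : exists s, s ^+ 2 + a * s + b = 0.
Proof.
have [mq sq] := monic_MXaddC b (monicXsubC (- a)).
have /closed_rootP[s /eqP es] : size (('X - (- a)%:P) * 'X + b%:P) != 1.
  by rewrite sq size_XsubC.
exists s; rewrite -es !(hornerC, hornerX, hornerN, hornerD, hornerM).
by ring.
Qed.

Lemma delta3_poly_monic : delta3_poly \is monic.
Proof.
have -> : delta3_poly = ('X - (8 * 'X + 16)%:P) * 'X +
    (64 * ('X ^+ 3 + 2 * 'X ^+ 2 + 'X + 1))%:P.
  rewrite /delta3_poly /cpar.
  by rewrite !(polyCN, polyC_exp, polyCM, polyCD, polyC1); ring.
exact: (monic_MXaddC _ (monicXsubC _)).1.
Qed.

Lemma delta3E : delta 3 = delta3_poly.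
Proof.
apply: multiplier_poly_uniq => //; split; first exact: delta3_poly_monic.
apply: (@eval_c_poly_inj (fun s => - (s ^+ 2 + s + 2))) => [c|s].
  have [s es] := complex_quadratic 1 (2 + c); exists s.
  by apply/eqP; rewrite -addr_eq0 -es; apply/eqP; ring.
by rewrite rmorphXn multres3_eval.
Qed.

Lemma delta1_poly_monic : delta1_poly \is monic.
Proof.
have -> : delta1_poly = ('X - 2%:P) * 'X + (4 * 'X)%:P.
  rewrite /delta1_poly /cpar.
  by rewrite !(polyCN, polyC_exp, polyCM, polyCD, polyC1); ring.
exact: (monic_MXaddC _ (monicXsubC _)).1.
Qed.

Lemma delta1E : delta 1 = delta1_poly.
Proof.
have mX : 'X \is @monic {poly int} by exact: monicX.
apply: multiplier_poly_uniq => //; split; first exact: delta1_poly_monic.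
rewrite expr1.
(* Here a is a fixed point, and the other one is 1 - a. *)
apply: (@eval_c_poly_inj (fun a => a - a ^+ 2)) => [c|a].
  have [a ea] := complex_quadratic (-1) c; exists a.
  by apply/eqP; rewrite -subr_eq0 -ea; apply/eqP; ring.
rewrite (@multres_eval 1 'X 2 _ [:: a; 1 - a]) ?size_polyX //; first last.
- rewrite dynatomic_1E fiter1E polyC1 rmorphD rmorphM rmorphB rmorph1 /= map_polyX map_cpar.
  rewrite big_cons big_seq1.
  by rewrite !(polyCN, polyC_exp, polyCD, polyC1); ring.
- by rewrite dynatomic_1E fiter1E; apply: (monic_MXaddC _ (monicXsubC _)).1.
- by rewrite /fiter /= derivD deriv_exp derivX derivC /=; ring.
rewrite big_cons big_seq1 map_polyX !hornerX /delta1_poly.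
rewrite !(rmorphXn, rmorph1, rmorph_nat, rmorphD, rmorphN, rmorphM) /=.
rewrite map_polyX map_cpar.
by ring.
Qed.

(** * Cyclotomic integers *)

(** The divisors of p^(a+1) other than itself are those of p^a, so the polynomial is 1 + y + ... +
    y^(p-1) with y = X^(p^a). *)
Lemma Cyclotomic_prime_power_1 p a : prime p -> ('Phi_(p ^ a.+1)).[1] = p%:R.
Proof.
move=> pr_p; have p0 := prime_gt0 pr_p.
have m0 : (0 < p ^ a)%N by rewrite expn_gt0 p0.
have k0 : (0 < p ^ a.+1)%N by rewrite expn_gt0 p0.
have e : 'Phi_(p ^ a.+1) * ('X^(p ^ a) - 1) = 'X^(p ^ a.+1) - 1.
  rewrite -!prod_Cyclotomic // -(big_cons _ _ (p ^ a.+1)%N (divisors _) xpredT).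
  apply: perm_big; apply: uniq_perm => [||d].
  - rewrite /= divisors_uniq andbT -dvdn_divisors //.
    by rewrite dvdn_Pexp2l ?prime_gt1 // ltnn.
  - exact: divisors_uniq.
  rewrite in_cons -!dvdn_divisors //; apply/idP/idP.
    case/orP=> [/eqP -> //|]; move/dvdn_trans; apply.
    by rewrite dvdn_exp2l.
  case/(dvdn_pfactor _ _ pr_p) => m; rewrite leq_eqVlt => /orP[/eqP -> ->|lm ->].
    by rewrite eqxx.
  by rewrite dvdn_exp2l ?orbT.
have nz : 'X^(p ^ a) - 1 != 0 :> {poly int}.
  by rewrite -size_poly_eq0 size_XnsubC.
have -> : 'Phi_(p ^ a.+1) = \sum_(i < p) ('X^(p ^ a)) ^+ i.
  apply: (mulIf nz); rewrite e mulrC -subrX1 -exprM.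
  by rewrite expnSr.
rewrite horner_sum (eq_bigr (fun=> 1)) => [|i _].
  by rewrite sumr_const card_ord.
by rewrite -exprM hornerXn expr1n.
Qed.

(** For w = z^(k/p), of order p, the powers w^0, ..., w^(p-1) sum to 0, so p is the sum of the
    differences 1 - w^j, all multiples of 1 - z. *)
Lemma dvd_one_sub_prim_root k p (z : algC) : k.-primitive_root z ->
  (p %| k)%N -> (1 < p)%N -> exists2 s, s \in Aint & p%:R = (1 - z) * s.
Proof.
move=> prim_z pk p1; have k0 := prim_order_gt0 prim_z.
have Az : z \in Aint by exact: Aint_prim_root prim_z.
have prim_w := dvdn_prim_root prim_z pk; set w := z ^+ _ in prim_w.
have s0 : \sum_(j < p) w ^+ j = 0.
  have w1 : w - 1 != 0.
    rewrite subr_eq0 -[w]expr1 -(prim_order_dvd prim_w) dvdn1.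
    by case: p p1 {pk prim_w w} => [|[]].
  by apply: (mulfI w1); rewrite mulr0 -subrX1 (prim_expr_order prim_w) subrr.
exists (\sum_(j < p) \sum_(i < k %/ p * j) z ^+ i).
  by apply: rpred_sum => j _; apply: rpred_sum => i _; apply: rpredX.
have -> : p%:R = \sum_(j < p) 1 :> algC by rewrite sumr_const card_ord.
rewrite mulr_sumr; transitivity (\sum_(j < p) 1 - \sum_(j < p) w ^+ j).
  by rewrite s0 subr0.
rewrite -sumrB; apply: eq_bigr => j _.
by rewrite -[1 - z]opprB mulNr -subrX1 opprB exprM.
Qed.

(** Such a k has two coprime divisors greater than 1. Both are multiples of 1 - z, and a Bezout
    relation makes 1 a multiple as well. *)
Lemma inv_one_sub_prim_root k (z : algC) : k.-primitive_root z -> (1 < k)%N ->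
  (forall p a, prime p -> k != (p ^ a.+1)%N) -> (1 - z)^-1 \in Aint.
Proof.
move=> prim_z k1 kpp; have k0 := ltnW k1.
have pr_p := pdiv_prime k1; set p := pdiv k in pr_p.
have [m co_pm Dk] := pfactor_coprime pr_p k0.
have l0 : (0 < logn p k)%N by rewrite logn_gt0 mem_primes pr_p k0 pdiv_dvd.
have m1 : (1 < m)%N.
  rewrite ltnNge; apply/negP => m1.
  have /eqP[] := kpp p (logn p k).-1 pr_p.
  rewrite prednK // {1}Dk; case: m m1 {co_pm} Dk => [|[|//]] _ //.
    by rewrite mul0n => ek; move: k0; rewrite ek.
  by rewrite mul1n.
have [s As Ds] := dvd_one_sub_prim_root prim_z (pdiv_dvd k) (prime_gt1 pr_p).
have mk : (m %| k)%N by rewrite Dk dvdn_mulr.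
have [t At Dt] := dvd_one_sub_prim_root prim_z mk m1.
have z1 : 1 - z != 0.
  apply/eqP => z0; move/eqP: Dt; rewrite z0 mul0r pnatr_eq0; lia.
have [i j e _] := @egcdnP p m (prime_gt0 pr_p).
have -> : (1 - z)^-1 = i%:R * s - j%:R * t.
  apply: (mulfI z1); rewrite mulfV // mulrBr mulrCA -Ds mulrCA -Dt.
  rewrite -!natrM e (eqP co_pm) natrD; ring.
by rewrite rpredB ?rpredM ?rpred_nat.
Qed.

Lemma norm_prim_root k (z : algC) : k.-primitive_root z -> `|z| = 1.
Proof.
move=> prim_z; apply/eqP; rewrite -(@pexpr_eq1 _ _ k) ?(prim_order_gt0 prim_z) //.
by rewrite -normrX (prim_expr_order prim_z) normr1.
Qed.

(** * The bound at the complex places *)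

(** Here x, y, t stand for |z|, |z^2 - z + 7| and z + z^*; the last hypothesis is |z^2 - z + 7|^2
    expanded in x and t. *)
Lemma cycle_bound_real (R : realFieldType) (x y t : R) : 0 <= x -> 0 <= y -> x * y <= 2 ->
  y <= 7 + x + x ^+ 2 ->
  y ^+ 2 = x ^+ 4 - x ^+ 2 * t + 7 * t ^+ 2 - 13 * x ^+ 2 - 7 * t + 49 ->
  (2 * x + 2) ^+ 3 * y < 343.
Proof.
move=> x0 y0 xy yx y2.
(* For x at least 3 the hypotheses are contradictory: y is at most 2/3, yet 28 y^2 is at least
   108. *)
have [x3|x3] := leP 3 x.
  have h1 : y <= 2/3 by nra.
  have h2 : 108 <= 28 * y ^+ 2.
    (* complete the square in [t], the real number [z + z^*] below *)
    have -> : 28 * y ^+ 2 = (14 * t - x ^+ 2 - 7) ^+ 2 +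
       (28 * x ^+ 2 + 28 * (x ^+ 2 - 7) ^+ 2 - (x ^+ 2 + 7) ^+ 2).
      by rewrite y2; ring.
    have h3 := sqr_ge0 (14 * t - x ^+ 2 - 7).
    have h4 : 9 <= x ^+ 2 by nra.
    have : 108 <= 28 * x ^+ 2 + 28 * (x ^+ 2 - 7) ^+ 2 - (x ^+ 2 + 7) ^+ 2.
      move: (x ^+ 2) h4 => X h4; nra.
    lra.
  nra.
have [x7|x7] := leP x (7/10).
  have h : (2 * x + 2) ^+ 3 <= (34/10) ^+ 3.
    by rewrite lerXn2r ?nnegrE; lra.
  have h' : y <= 7 + 7/10 + (7/10)^+2 by nra.
  have : (2 * x + 2) ^+ 3 * y <= (34/10) ^+ 3 * (7 + 7/10 + (7/10)^+2).
    by apply: ler_pM => //; apply: exprn_ge0; lra.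
  lra.
have -> : (2 * x + 2) ^+ 3 * y = 8 * ((x ^+ 2 + 3 * x + 3) * (x * y) + y) by ring.
have : (x ^+ 2 + 3 * x + 3) * (x * y) <= (x ^+ 2 + 3 * x + 3) * 2.
  by apply: ler_wpM2l => //; nra.
move=> h.
have : y <= 2 / x by rewrite ler_pdivlMr; lra.
(* On [7/10, 3] the convex functions x^2 and 2/x lie below their chords, which leaves a linear
   inequality. *)
have : x ^+ 2 <= (37/10) * x - 21/10 by nra.
have : x * (2 / x) = 2 by field; lra.
move: (2 / x) => w e1 e2 e3.
have : w <= 20/7 + 2/3 - (20/21) * x by nra.
lra.
Qed.

Lemma cycle_bound (z : algC) : `|z| * `|z ^+ 2 - z + 7| <= 2 ->
  (2 * `|z| + 2) ^+ 3 * `|z ^+ 2 - z + 7| < 343.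
Proof.
move=> h.
have xr : `|z| \is Num.real by apply: normr_real.
have yr : `|z ^+ 2 - z + 7| \is Num.real by apply: normr_real.
have tr : z + z^* \is Num.real.
  by rewrite CrealE rmorphD /= conjCK addrC.
have H : ((2 * `|z| + 2) ^+ 3 * `|z ^+ 2 - z + 7| < 343) =
    ((2 * in_algR xr + 2) ^+ 3 * in_algR yr < 343) by [].
rewrite H; apply: (@cycle_bound_real algR _ _ (in_algR tr)).
  - exact: normr_ge0.
  - exact: normr_ge0.
  - exact: h.
  - suff : `|z ^+ 2 - z + 7| <= 7 + `|z| + `|z| ^+ 2 by [].
    have -> : z ^+ 2 - z + 7 = 7 - z + z ^+ 2 by ring.
    apply: le_trans (ler_normD _ _) _; rewrite normrX lerD2r.
    by apply: le_trans (ler_normD _ _) _; rewrite normrN normr_nat.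
- suff : `|z ^+ 2 - z + 7| ^+ 2 = `|z| ^+ 4 - `|z| ^+ 2 * (z + z^*) +
      7 * (z + z^*) ^+ 2 - 13 * `|z| ^+ 2 - 7 * (z + z^*) + 49.
    by move=> e; apply: val_inj.
  rewrite (exprM _ 2 2) !normCK rmorphD rmorphB rmorphXn rmorph_nat /=.
  by ring.
Qed.

Lemma rmorph_quadratic (R S : comNzRingType) (f : {rmorphism R -> S}) x :
  f (x ^+ 2 - x + 7) = f x ^+ 2 - f x + 7.
Proof. by rewrite rmorphD rmorphB rmorphXn rmorph_nat. Qed.

(** Composing the cyclotomic polynomial with the monic integral cubic gives a monic integral
    polynomial that vanishes at x. *)
Lemma Aint_cubic_root k (z x : algC) : k.-primitive_root z ->
  x ^+ 3 - x ^+ 2 + 7 * x + 1 = z -> x \in Aint.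
Proof.
move=> prim_z ex.
pose r : {poly int} := - 'X^2 + 7 *: 'X + 1; pose g := 'X^3 + r.
have sz_r : (size r < 4)%N.
  apply: leq_trans (size_polyD _ _) _; rewrite size_poly1 geq_max andbT.
  apply: leq_trans (size_polyD _ _) _; rewrite size_polyN size_polyXn geq_max /=.
  by apply: leq_trans (size_scale_leq _ _) _; rewrite size_polyX.
have sz_g : size g = 4 by rewrite /g size_polyDl size_polyXn.
have mon_g : g \is monic.
  by rewrite monicE /g lead_coefDl ?lead_coefXn ?size_polyXn.
apply: (@root_monic_Aint (map_poly intr ('Phi_k \Po g))).
- rewrite map_comp_poly /root horner_comp.
  have -> : (map_poly intr g).[x] = z.
    rewrite /g /r !rmorphD rmorphN /= map_polyZ !map_polyXn map_polyX rmorph1 /=.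
    by rewrite !hornerE -ex.
  by rewrite (Cintr_Cyclotomic prim_z) -/(root _ _) root_cyclotomic.
- rewrite monic_map // monicE lead_coef_comp ?sz_g //.
  by rewrite (monicP mon_g) (monicP (Cyclotomic_monic k)) expr1n mul1r.
- by apply/polyOverP => i; rewrite coef_map /= rpred_int.
Qed.

(* delta_3(x, c) as a polynomial in c *)
Definition delta3_at (R : comNzRingType) (x : R) : {poly R} :=
  64 *: 'X^3 + (128 *: 'X^2 + (64 - 8 * x) *: 'X + (x ^+ 2 - 16 * x + 64)%:P).

Lemma horner_map_delta3 (R : comNzRingType) (x : R) :
  (map_poly (map_poly (intr : int -> R)) delta3_poly).[x%:P] = delta3_at x.
Proof.
have -> : map_poly (map_poly (intr : int -> R)) delta3_poly =
    'X ^+ 2 - (8 * ('X)%:P + 16) * 'X +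
    64 * (('X)%:P ^+ 3 + 2 * ('X)%:P ^+ 2 + ('X)%:P + 1).
  rewrite /delta3_poly /cpar.
  rewrite !(rmorphXn, rmorph1, rmorph_nat, rmorphD, rmorphN, rmorphM) /=.
  rewrite map_polyX !map_polyC /= map_polyX.
  by ring.
have c n : (n%:R : {poly {poly R}}).[x%:P] = n%:R by rewrite -polyC_natr hornerC.
rewrite !(hornerD, hornerN, hornerM, horner_exp, hornerX, hornerC, c) /delta3_at -!mul_polyC.
rewrite !(polyCD, polyCN, polyCM, polyC_exp, polyC1).
by ring.
Qed.

Lemma size_delta3_at (F : fieldType) (x : F) : 64 != 0 :> F ->
  size (delta3_at x) = 4 /\ lead_coef (delta3_at x) = 64.
Proof.
move=> n64; rewrite /delta3_at; set p := 128 *: _ + _ + _.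
have sp : (size p < 4)%N.
  apply: leq_ltn_trans (size_polyD _ _) _; rewrite gtn_max.
  rewrite (leq_ltn_trans (size_polyC_leq1 _)) // andbT.
  apply: leq_ltn_trans (size_polyD _ _) _; rewrite gtn_max.
  rewrite (leq_ltn_trans (size_scale_leq _ _)) ?size_polyXn //.
  by rewrite (leq_ltn_trans (size_scale_leq _ _)) ?size_polyX.
have s64 : size (64 *: 'X^3 : {poly F}) = 4 by rewrite size_scale // size_polyXn.
by rewrite size_polyDl ?lead_coefDl ?s64 // lead_coefZ lead_coefXn mulr1.
Qed.

Lemma coprimep_prod (F : fieldType) (I : Type) (r : seq I) (f : I -> {poly F}) q :
  (forall i, coprimep q (f i)) -> coprimep q (\prod_(i <- r) f i).
Proof.
move=> co; apply: (big_ind (coprimep q)) => [|x y cx cy|i _]; last exact: co.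
  exact: coprimep1.
by rewrite coprimepMr cx.
Qed.

Lemma prod_coprime_dvdp (F : fieldType) (I : eqType) (r : seq I)
    (f : I -> {poly F}) q : uniq r ->
  (forall i j, i != j -> coprimep (f i) (f j)) -> (forall i, f i %| q) ->
  \prod_(i <- r) f i %| q.
Proof.
move=> + co dv; elim: r => [|i r IH] /=; first by rewrite big_nil dvd1p.
case/andP => ir ur; rewrite big_cons Gauss_dvdp ?dv ?IH //.
rewrite big_seq; apply: (big_ind (coprimep (f i))) => [|x y cx cy|j jr].
- exact: coprimep1.
- by rewrite coprimepMr cx.
- by apply: co; apply: contraNneq ir => ->.
Qed.

Lemma irreducible_size2 (F : fieldType) (p : {poly F}) :
  size p = 2 -> irreducible_poly p.
Proof.
move=> sp; split; rewrite ?sp // => q q1 dq.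
have p0 : p != 0 by rewrite -size_poly_eq0 sp.
rewrite -dvdp_size_eqp // eqn_leq dvdp_leq //= sp.
have q0 : q != 0 by apply: contraTneq dq => ->; rewrite dvd0p.
by move: q1; rewrite -size_poly_eq0 in q0; case: (size q) q0 => [|[|]].
Qed.

(** * The Galois action on Q(w) *)

Section CyclotomicField.
Variables (Qn : splittingFieldType rat) (QnC : {rmorphism Qn -> algC}).
Hypothesis galQn : galois 1 {:Qn}.
Hypothesis autQn : forall nu : gal_of {:Qn},
  {mu : {rmorphism algC -> algC} | {morph QnC : a / nu a >-> mu a}}.
Variables (k : nat) (w : Qn).
Hypothesis prim_w : k.-primitive_root w.
Hypothesis gen_w : <<1; w>>%VS = fullv.

Local Notation G := ('Gal({:Qn} / 1))%g.

Let QnC_inj := fmorph_inj QnC.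

Lemma rmorph_gen_eq (L : fieldType) (f g : {rmorphism Qn -> L}) :
  f w = g w -> f =1 g.
Proof.
move=> fgw z; have : z \in <<1; w>>%VS by rewrite gen_w memvf.
case/Fadjoin_polyP => p /polyOverP p1 ->; rewrite !horner_coef !rmorph_sum /=.
apply: eq_bigr => i _; rewrite !rmorphM !rmorphXn /= fgw; congr (_ * _).
by have /vlineP[c ->] := p1 i; rewrite alg_num_field !fmorph_rat.
Qed.

Lemma gal_gen_inj (s t : gal_of {:Qn}) : s w = t w -> s = t.
Proof. by move=> st; apply/eqP/gal_eqP => x _; apply: rmorph_gen_eq. Qed.

Lemma gal_prim_root (s : gal_of {:Qn}) : k.-primitive_root (s w).
Proof. by rewrite fmorph_primitive_root. Qed.

Lemma in_galQ (s : gal_of {:Qn}) : s \in G.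
Proof.
rewrite gal_kHom ?sub1v //; apply/kAHomP => x /vlineP[c ->].
by rewrite alg_num_field fmorph_rat.
Qed.

Lemma rat_of_fixed z : (forall s : gal_of {:Qn}, s z = z) -> exists c : rat, z = c%:A.
Proof.
move=> fix_z; have /vlineP[c ->] : z \in 1%VS.
  rewrite -(galois_fixedField galQn); apply/fixedFieldP; rewrite ?memvf //.
by exists c.
Qed.

Lemma gal_prodJ (T : comNzRingType) (F : Qn -> T) z (s : gal_of {:Qn}) :
  \prod_(t in G) F (s (t z)) = \prod_(t in G) F (t z).
Proof.
rewrite [RHS](reindex_inj (mulIg s)) /=; apply: eq_big => t.
  by rewrite !in_galQ.
by rewrite galM ?memvf.
Qed.

(** The product divides ['Phi_k] because the conjugates of w are distinct primitive roots.
    Conversely, it is rational and vanishes at w, whose minimal polynomial is ['Phi_k]. *)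
Lemma Cyclotomic_galE :
  map_poly (intr : int -> Qn) 'Phi_k = \prod_(s in G) ('X - (s w)%:P).
Proof.
set Q := \prod_(s in G) _.
have Qmon : Q \is monic by apply: monic_prod => s _; apply: monicXsubC.
have Qseq : Q = \prod_(z <- [seq s w | s : gal_of {:Qn} in G]) ('X - z%:P).
  by rewrite big_image.
have Dphi : map_poly (intr : int -> algC) 'Phi_k =
    map_poly QnC (map_poly (intr : int -> Qn) 'Phi_k).
  by rewrite -map_poly_comp; apply: eq_map_poly => c /=; rewrite rmorph_int.
have prim_C (s : gal_of {:Qn}) : k.-primitive_root (QnC (s w)).
  by rewrite fmorph_primitive_root gal_prim_root.
apply/eqP; rewrite -eqp_monic ?Qmon ?monic_map ?Cyclotomic_monic //.
apply/andP; split; last first.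
  rewrite Qseq; apply: uniq_roots_dvdp.
    apply/allP => _ /imageP[s _ ->].
    rewrite -(fmorph_root QnC) -Dphi.
    by rewrite (Cintr_Cyclotomic (prim_C s)) root_cyclotomic.
  rewrite uniq_rootsE map_inj_in_uniq ?enum_uniq // => s t _ _.
  exact: gal_gen_inj.
have [q Dq] : exists q : {poly rat}, Q = map_poly (in_alg Qn) q.
  suff /fin_all_exists[c Dc] : forall i : 'I_(size Q), exists c : rat, Q`_i = c%:A.
    exists (\poly_(i < size Q) (if insub i is Some j then c j else 0)).
    apply/polyP => i; rewrite coef_map coef_poly.
    case: ltnP => h; last by rewrite nth_default //= scale0r.
    by rewrite insubT /= -Dc.
  move=> i; apply: rat_of_fixed => s.
  suff e : map_poly s Q = Q by rewrite -coef_map e.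
  rewrite rmorph_prod -[RHS](gal_prodJ (fun z => 'X - z%:P) w s).
  by apply: eq_bigr => t _; rewrite /= map_polyXsubC.
have Qw : root Q w.
  rewrite Qseq root_prod_XsubC; apply/imageP; exists 1%g; rewrite ?in_galQ //.
  by rewrite gal_id.
have [p [Dp mon_p] dv_p] := minCpolyP (QnC w).
have prim_Cw : k.-primitive_root (QnC w) by rewrite fmorph_primitive_root.
rewrite -(dvdp_map QnC) -Dphi (Cintr_Cyclotomic prim_Cw).
rewrite -(minCpoly_cyclotomic prim_Cw) Dp.
have -> : map_poly QnC Q = map_poly ratr q.
  by rewrite Dq -map_poly_comp; apply: eq_map_poly => c /=;
    rewrite alg_num_field fmorph_rat.
rewrite dvdp_map -dv_p.
have -> : map_poly ratr q = map_poly QnC Q.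
  by rewrite Dq -map_poly_comp; apply: eq_map_poly => c /=;
    rewrite alg_num_field fmorph_rat.
by rewrite fmorph_root.
Qed.

(** Complex conjugation restricts to [Qn], where it inverts every primitive root and so commutes
    with the Galois group; hence one element serves all embeddings. *)
Lemma gal_conj z : exists z', forall s : gal_of {:Qn},
  QnC (s z') = (QnC (s z))^*.
Proof.
have [c Dc] := restrict_aut_to_normal_num_field QnC Num.conj.
exists (c z) => s; rewrite -[RHS]Dc.
apply: (rmorph_gen_eq (f := QnC \o s \o c) (g := QnC \o c \o s)) => /=.
have cV (x : Qn) : k.-primitive_root x -> c x = x^-1.
  move=> prim_x; apply: QnC_inj; rewrite Dc fmorphV.
  have nx : `|QnC x| = 1.
    by apply: (@norm_prim_root k); rewrite fmorph_primitive_root.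
  by rewrite invC_norm nx expr1n invr1 mul1r.
by rewrite !cV ?fmorphV ?gal_prim_root.
Qed.

(** * Norms of cyclotomic integers *)

Definition normQn z : algC := \prod_(s in G) QnC (s z).

Lemma normQnM x y : normQn (x * y) = normQn x * normQn y.
Proof. by rewrite -big_split; apply: eq_bigr => s _; rewrite !rmorphM. Qed.

Lemma normQn_int n : normQn n%:~R = n%:~R ^+ #|G|.
Proof.
rewrite /normQn (eq_bigr (fun=> n%:~R)) ?prodr_const // => s _.
by rewrite !rmorph_int.
Qed.

Lemma Aint_gal z (s : gal_of {:Qn}) : QnC z \in Aint -> QnC (s z) \in Aint.
Proof. by move=> Az; have [mu ->] := autQn s; rewrite Aint_aut. Qed.

Lemma normQn_Cint z : QnC z \in Aint -> normQn z \in Num.int.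
Proof.
move=> Az; apply: Cint_rat_Aint; last first.
  by apply: rpred_prod => s _; apply: Aint_gal.
rewrite /normQn -rmorph_prod.
have /rat_of_fixed[c ->] : forall s : gal_of {:Qn},
    s (\prod_(t in G) t z) = \prod_(t in G) t z.
  by move=> s; rewrite rmorph_prod; apply: (gal_prodJ id).
by rewrite alg_num_field fmorph_rat rpred_rat.
Qed.

Lemma normQn_ge1 z : QnC z \in Aint -> z != 0 -> 1 <= `|normQn z|.
Proof.
move=> Az z0; apply: norm_intr_ge1; first exact: normQn_Cint.
by apply/prodf_neq0 => s _; rewrite !fmorph_eq0.
Qed.

Lemma normQn_lt (B : algC) z : 0 <= B ->
  (forall s : gal_of {:Qn}, `|QnC (s z)| < B) -> `|normQn z| < B ^+ #|G|.
Proof.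
move=> B0 ltB; rewrite /normQn normr_prod -prodr_const.
apply: ltr_prod => [|s _]; last by rewrite normr_ge0 ltB.
by apply/hasP; exists 1%g; rewrite ?mem_index_enum ?in_galQ.
Qed.

Lemma Aint_small_eq0 z : QnC z \in Aint ->
  (forall s : gal_of {:Qn}, `|QnC (s z)| < 1) -> z = 0.
Proof.
move=> Az lt1; apply/eqP; apply: contraT => z0.
have := normQn_lt ler01 lt1; rewrite expr1n => lt_N1.
by have := normQn_ge1 Az z0; rewrite (lt_geF lt_N1).
Qed.

(** The norm is 1 or -1, so the inverse is the norm times the product of the other conjugates. *)
Lemma Aint_inv_norm1 z : QnC z \in Aint -> `|normQn z| = 1 -> QnC z^-1 \in Aint.
Proof.
move=> Az N1.
have z0 : z != 0.
  apply: contra_eq_neq N1 => ->; rewrite /normQn (bigD1 1%g) ?in_galQ //=.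
  by rewrite !rmorph0 mul0r normr0 eq_sym oner_eq0.
have NN : normQn z * normQn z = 1.
  by have := intr_normK (normQn_Cint Az); rewrite N1 expr1n -expr2 => <-.
have -> : QnC z^-1 = normQn z * \prod_(s in G | s != 1%g) QnC (s z).
  apply: (mulfI (_ : QnC z != 0)); first by rewrite fmorph_eq0.
  rewrite fmorphV mulfV ?fmorph_eq0 // mulrCA -[LHS]NN; congr (_ * _).
  by rewrite {1}/normQn (bigD1 1%g) ?in_galQ //= gal_id.
apply: rpredM; first exact/Aint_Cint/normQn_Cint.
by apply: rpred_prod => s _; apply: Aint_gal.
Qed.

Lemma normQn_one_sub : normQn (1 - w) = ('Phi_k).[1]%:~R.
Proof.
have -> : ('Phi_k).[1]%:~R = QnC (map_poly intr 'Phi_k).[1].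
  have := horner_map (intr : {rmorphism int -> Qn}) 'Phi_k 1.
  by rewrite rmorph1 => ->; rewrite rmorph_int.
rewrite Cyclotomic_galE horner_prod rmorph_prod; apply: eq_bigr => s _.
by rewrite rmorphB rmorph1 hornerXsubC.
Qed.

Lemma gen_sub1_neq0 : (1 < k)%N -> w - 1 != 0.
Proof.
move=> k1; rewrite subr_eq0 -[w]expr1 -(prim_order_dvd prim_w) dvdn1.
by rewrite gtn_eqF.
Qed.

(* The norm of [w - 1] is prime when [k] is a prime power, and [w - 1] is a unit
   otherwise. *)
Lemma Aint_factor_unit x y : QnC x \in Aint -> QnC y \in Aint -> (1 < k)%N ->
  x * y = w - 1 -> QnC x^-1 \in Aint \/ QnC y^-1 \in Aint.
Proof.
move=> Ax Ay k1 xy.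
have w1 := gen_sub1_neq0 k1.
have := w1; rewrite -xy mulf_eq0 negb_or => /andP[x0 y0].
have [[p [a [pr_p Dk]]]|kpp] :
    (exists p a, prime p /\ k = (p ^ a.+1)%N) \/
    (forall p a, prime p -> k != (p ^ a.+1)%N).
(* Both p and a would be at most k, so the search is finite and the alternative decidable. *)
- have [/existsP[p /existsP[a /andP[pr_p /eqP e]]]|no] :=
    boolP [exists p : 'I_k.+1, [exists a : 'I_k.+1, prime p && (k == p ^ a.+1)%N]].
    by left; exists p, a.
  right=> p a pr_p; apply: contra no => /eqP e.
  have p1 := prime_gt1 pr_p.
  have ak : (a < k.+1)%N by rewrite e ltnS ltnW // (leq_trans (ltnSn a)) // ltnW // ltn_expl.
  have pk : (p < k.+1)%N by rewrite ltnS e -{1}[p]expn1 leq_exp2l.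
  apply/existsP; exists (Ordinal pk); apply/existsP; exists (Ordinal ak).
  by rewrite /= pr_p e eqxx.
- have : normQn x * normQn y = normQn (-1) * p%:R.
    rewrite -normQnM xy (_ : w - 1 = -1 * (1 - w)); last by ring.
    rewrite normQnM normQn_one_sub.
    by rewrite Dk Cyclotomic_prime_power_1 // rmorph_nat.
  move/(congr1 (fun z => `|z|)).
  rewrite !normrM normr_nat (_ : -1 = (-1)%:~R) // normQn_int normrX normrN1 expr1n mul1r.
  have /intrP[i Di] := normQn_Cint Ax; have /intrP[j Dj] := normQn_Cint Ay.
  rewrite Di Dj -!intr_norm -intrM pmulrn => /intr_inj e.
  (* The norms of x and y multiply to a prime up to sign, so one of them is 1 or -1. *)
  have : (`|i| * `|j| = p)%N by move: e; lia.
  move=> ij; have : (`|i| %| p)%N by rewrite -ij dvdn_mulr.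
  case/primeP: (pr_p) => _ dp /dp /orP[] /eqP ei.
    left; apply: Aint_inv_norm1 => //; rewrite Di -intr_norm.
    by rewrite (_ : `|i| = 1) //; lia.
  right; apply: Aint_inv_norm1 => //; rewrite Dj -intr_norm.
  have p0 := prime_gt0 pr_p; have j1 : `|j|%N = 1%N.
    by apply/eqP; rewrite -(eqn_pmul2l p0) muln1 -{2}ij ei.
  by rewrite (_ : `|j| = 1) //; lia.
left.
have -> : x^-1 = - y * (1 - w)^-1.
  apply: (mulfI x0); rewrite mulfV // mulrA mulrN xy opprB divff //.
  by rewrite -oppr_eq0 opprB.
rewrite rmorphM rmorphN rpredM ?rpredN // fmorphV rmorphB rmorph1.
apply: (@inv_one_sub_prim_root k) => //.
by rewrite fmorph_primitive_root.
Qed.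

(** * The equation g(u) = w in Q(w) *)

Lemma no_cyclotomic_cubic_root u : (1 < k)%N ->
  u ^+ 3 - u ^+ 2 + 7 * u + 1 <> w.
Proof.
move=> k1 eu; pose q := u ^+ 2 - u + 7.
have uq : u * q = w - 1 by rewrite -eu /q; ring.
have w0 : w != 0.
  apply/eqP => e; move/eqP: (prim_expr_order prim_w).
  by rewrite e expr0n gtn_eqF ?(prim_order_gt0 prim_w) // eq_sym oner_eq0.
have w1 := gen_sub1_neq0 k1.
have := w1; rewrite -uq mulf_eq0 negb_or => /andP[u0 q0].
have norm_w (s : gal_of {:Qn}) : `|QnC (s w)| = 1.
  by apply: (@norm_prim_root k); rewrite fmorph_primitive_root gal_prim_root.
(* v is u^* realised inside [Qn], compatibly with every embedding; likewise p below is q^*. *)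
have [v Dv] := gal_conj u.
have Dv1 : QnC v = (QnC u)^* by have := Dv 1%g; rewrite !gal_id.
pose p := v ^+ 2 - v + 7.
have Dp (s : gal_of {:Qn}) : QnC (s p) = (QnC (s q))^*.
  by rewrite !rmorph_quadratic Dv.
have Dp1 : QnC p = (QnC q)^* by have := Dp 1%g; rewrite !gal_id.
have Cw : (QnC w)^* = (QnC w)^-1.
  by have := norm_w 1%g; rewrite gal_id invC_norm => ->; rewrite expr1n invr1 mul1r.
have v0 : v != 0 by rewrite -(fmorph_eq0 QnC) Dv1 conjC_eq0 fmorph_eq0.
have p0 : p != 0 by rewrite -(fmorph_eq0 QnC) Dp1 conjC_eq0 fmorph_eq0.
have vp : v * p = w^-1 - 1.
  apply: (fmorph_inj QnC); rewrite rmorphM Dv1 Dp1 -!rmorphM uq.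
  by rewrite !rmorphB !rmorph1 /= Cw fmorphV.
pose A := q / p; pose B := v / u.
have DA : q = A * p by rewrite /A divfK.
have DB : v = B * u by rewrite /B divfK.
(* Since w^* = 1/w, conjugating uq = w - 1 gives vp = -uq/w, which ties B to A. *)
have BA : B = - A / w.
  rewrite /A /B; apply: (mulIf u0); apply: (mulIf p0); rewrite divfK // vp.
  have -> : - (q / p) / w * u * p = - (u * q) / w by field; rewrite w0 p0.
  by rewrite uq; field.
have A0 : A != 0 by rewrite mulf_neq0 ?invr_neq0.
have AB : A = - B * w by rewrite BA; field.
have normA (s : gal_of {:Qn}) : `|QnC (s A)| = 1.
  rewrite /A !fmorph_div Dp normf_div norm_conjC divff //.
  by rewrite normr_eq0 !fmorph_eq0.
have normB (s : gal_of {:Qn}) : `|QnC (s B)| = 1.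
  rewrite /B !fmorph_div Dv normf_div norm_conjC divff //.
  by rewrite normr_eq0 !fmorph_eq0.
have Aw : QnC w \in Aint by apply: (@Aint_prim_root k); rewrite fmorph_primitive_root.
have Au : QnC u \in Aint.
  apply: (@Aint_cubic_root k (QnC w)); first by rewrite fmorph_primitive_root.
  by rewrite -eu 2!rmorphD rmorphB !rmorphXn rmorphM rmorph_nat rmorph1.
have Av : QnC v \in Aint by rewrite Dv1 Aint_aut.
have Aq : QnC q \in Aint.
  by rewrite rmorph_quadratic rpredD ?rpred_nat // rpredB ?rpredX.
have unit_uq := Aint_factor_unit Au Aq k1 uq.
(* If u is a unit, then B = v/u is integral and A = -Bw; if q is a unit, then so is its conjugate
   p. *)
have AA : QnC A \in Aint.
  case: unit_uq => h.
    rewrite AB /B !(rmorphM, rmorphN); apply: rpredM => //; rewrite rpredN.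
    exact: rpredM.
  rewrite /A rmorphM; apply: rpredM => //.
  by rewrite fmorphV Dp1 -fmorphV Aint_aut -fmorphV.
pose M := (A * B ^+ 2 - 1) * u - (A * B - 1).
(* Put v = Bu in Ap - q = 0: the constant terms give 7(A - 1), and the rest is uM. *)
have uM : u * M = - 7 * (A - 1).
  have e : A * p - q = 0 by rewrite -DA subrr.
  apply/eqP; rewrite -subr_eq0 -e /M /p /q DB; apply/eqP; ring.
have [A1|A1] := eqVneq A 1; last first.
  pose s := (A - 1) / u.
  have DM : M = - 7 * s.
    by apply: (mulfI u0); rewrite uM /s; field.
  have s0 : s != 0 by rewrite mulf_neq0 ?invr_neq0 // subr_eq0.
  have AA1 : QnC (A - 1) \in Aint by rewrite rmorphB rmorph1 rpredB.
  have AM : QnC M \in Aint.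
    have ABint : QnC (A * B) \in Aint.
      (* Here AB = -A^2/w, and 1/w = vp + 1 is integral. *)
      have -> : A * B = - A ^+ 2 * (v * p + 1) by rewrite vp BA; field.
      rewrite rmorphM rmorphN rmorphXn rmorphD rmorph1 [QnC (v * p)]rmorphM.
      apply: rpredM; first by rewrite rpredN rpredX.
      apply: rpredD; rewrite ?rpred1 //; apply: rpredM => //.
      by rewrite Dp1 Aint_aut.
    have -> : M = A * B * v - u - (A * B - 1) by rewrite /M DB; ring.
    rewrite 3!rmorphB rmorph1 rmorphM.
    by rewrite !(rpredB, rpredM, rpred1).
  (* if q is the unit, then (A - 1) q = u ((u - 1) (A - 1) - M) *)
  have As : QnC s \in Aint.
    case: unit_uq => h; first by rewrite rmorphM rpredM.
    have -> : s = ((u - 1) * (A - 1) - M) * q^-1.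
      apply: (mulIf q0); rewrite divfK //; apply: (mulfI u0).
      by rewrite mulrBr uM /s /q; field.
    rewrite rmorphM rpredM // rmorphB rpredB // rmorphM rpredM //.
    by rewrite rmorphB rmorph1 rpredB.
  have /(normQn_ge1) : QnC (s ^+ 3 * q) \in Aint.
    by rewrite rmorphM rmorphXn rpredM ?rpredX.
  rewrite mulf_neq0 ?expf_neq0 // => /(_ isT).
  have : `|normQn (M ^+ 3 * q)| < 343 ^+ #|G|.
    apply: normQn_lt => [|t]; first by rewrite ler0n.
    have h : `|QnC (t u)| * `|QnC (t u) ^+ 2 - QnC (t u) + 7| <= 2.
      have -> : QnC (t u) ^+ 2 - QnC (t u) + 7 = QnC (t q).
        by rewrite !rmorph_quadratic.
      rewrite -normrM -!rmorphM uq !rmorphB !rmorph1.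
      apply: le_trans (ler_normB _ _) _; rewrite norm_w normr1.
      by rewrite -[1 + 1]/(2%:R).
    apply: le_lt_trans (cycle_bound h).
    have -> : QnC (t u) ^+ 2 - QnC (t u) + 7 = QnC (t q).
      by rewrite !rmorph_quadratic.
    rewrite 2!rmorphM 2!rmorphXn normrM normrX ler_wpM2r //.
    apply: lerXn2r; rewrite ?nnegrE ?addr_ge0 ?mulr_ge0 //.
    have le2 (y : Qn) : `|QnC (t y)| = 1 -> `|QnC (t (y - 1))| <= 2.
      move=> ny; rewrite !rmorphB !rmorph1; apply: le_trans (ler_normB _ _) _.
      by rewrite ny normr1 -[1 + 1]/(2%:R).
    rewrite /M 2!rmorphB; apply: le_trans (ler_normB _ _) _; apply: lerD.
      rewrite 2!rmorphM normrM ler_wpM2r // le2 //.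
      by rewrite 2!rmorphM 2!rmorphXn normrM normrX normA normB expr1n mulr1.
    by rewrite le2 // 2!rmorphM normrM normA normB mulr1.
  (* As M = -7s, the bound would force the norm of s^3 q below 1. *)
  have -> : M ^+ 3 * q = (- 343%:Z)%:~R * (s ^+ 3 * q).
    by rewrite DM; ring.
  rewrite normQnM normQn_int normrM normrX -intr_norm.
  set N := `|normQn _|; rewrite -[X in _ < X]mulr1 => h1 h2.
  have c0 : 0 < 343 ^+ #|G| :> algC by rewrite exprn_gt0 // ltr0n.
  by move: h1 h2; rewrite ltr_pM2l // => h1; rewrite (lt_geF h1).
have M0 : M = 0 by apply: (mulfI u0); rewrite uM A1; ring.
move: BA M0; rewrite /M A1 => BA M0.
(* With A = 1, M = 0 reads (B - 1)((B + 1)u - 1) = 0. *)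
have [B1|B1] := eqVneq B 1.
  have wN : w = -1.
    by have := congr1 (fun z => z * w) BA; rewrite B1 mul1r divfK.
  have vu : v = u by rewrite DB B1 mul1r.
  suff u00 : u = 0 by rewrite u00 eqxx in u0.
  (* Every conjugate of u is real, so those of q = (u - 1/2)^2 + 27/4 are at least 27/4; as |u||q| =
     2 at each place, every |u| is below 1. *)
  apply: (Aint_small_eq0) => // t.
  have ur : QnC (t u) \is Num.real by rewrite CrealE -Dv vu.
  have h : `|QnC (t u)| * `|QnC (t q)| = 2.
    rewrite -normrM -!rmorphM uq wN !rmorphB !rmorph1 !rmorphN !rmorph1.
    by rewrite -opprD normrN -[1 + 1]/(2%:R) normr_nat.
  rewrite real_ltNge ?normr_real ?real1 //; apply/negP => h1.
  have h2 : 27/4 <= `|QnC (t q)|.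
    have -> : QnC (t q) = (QnC (t u) - 1/2) ^+ 2 + 27/4.
      by rewrite !rmorph_quadratic; field.
    have sq0 : 0 <= (QnC (t u) - 1/2) ^+ 2.
      by rewrite real_exprn_even_ge0 // rpredB // rpred_div ?rpred1 ?rpred_nat.
    by rewrite ger0_norm ?addr_ge0 ?divr_ge0 ?ler0n // lerDr.
  have h3 : `|QnC (t q)| <= 2 by rewrite -h ler_peMl.
  have := le_trans h2 h3; rewrite ler_pdivrMr ?ltr0n //.
  by rewrite -natrM ler_nat.
have Bu : (B + 1) * u = 1.
  apply: (mulfI (_ : B - 1 != 0)); first by rewrite subr_eq0.
  by rewrite mulr1 -[RHS]addr0 -M0; ring.
have vu : v = 1 - u by rewrite -Bu DB; ring.
have wuv : w = - u / v by rewrite DB BA; field; rewrite w0 u0 oppr_eq0 oner_eq0.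
(* Y = -q, and at each place n = |u|^2 satisfies n(n - 7) = 1, so n > 7 and the conjugate n - 7 of Y
   lies between 0 and 1. *)
pose Y := u * v - 7.
have YX : Y * (u * v) = 1.
  have -> : Y = - q by rewrite /Y /q vu; ring.
  have -> : - q * (u * v) = - (u * q) * v by ring.
  rewrite uq wuv; transitivity (u + v); first by field.
  by rewrite vu; ring.
have Y0 : Y = 0.
  apply: (Aint_small_eq0) => [|t].
    by rewrite rmorphB rmorphM rmorph_nat rpredB ?rpredM ?rpred_nat.
  have := congr1 (fun z => QnC (t z)) YX.
  rewrite /Y !rmorphM !rmorphB !rmorphM !rmorph_nat !rmorph1 Dv -normCK.
  set n := `|QnC (t u)| ^+ 2 => e.
  have n0 : 0 < n by rewrite exprn_gt0 // normr_gt0 !fmorph_eq0.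
  have n7 : 0 < n - 7 by rewrite -(pmulr_lgt0 _ n0) e ltr01.
  rewrite ger0_norm ?ltW //.
  have n1 : 1 < n by apply: (@lt_trans _ _ 7); rewrite ?ltr1n // -subr_gt0.
  by rewrite -[X in _ < X]e ltr_pMr.
by move/eqP: YX; rewrite Y0 mul0r eq_sym oner_eq0.
Qed.

(** * Irreducibility over Q by Galois descent *)

Let natr_neq0 n : (0 < n)%N -> n%:R != 0 :> Qn.
Proof. by move=> n0; rewrite -(fmorph_eq0 QnC) rmorph_nat pnatr_eq0 -lt0n. Qed.

Lemma delta3_at_no_root x : (1 < k)%N -> ~~ root (delta3_at w) x.
Proof.
move=> k1; apply/negP => /eqP.
rewrite /delta3_at 3!hornerD hornerC 3!hornerZ hornerX !hornerXn => e.
have w8 : 8 - w != 0.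
  rewrite subr_eq0; apply/eqP => e8.
  have : `|QnC w| = 1 by apply: (@norm_prim_root k); rewrite fmorph_primitive_root.
  by rewrite -e8 rmorph_nat normr_nat => /eqP; rewrite pnatr_eq1.
(* At c = 0 the cubic takes the value (8 - w)^2. *)
have x0 : x != 0.
  apply: contraNneq w8 => x0; move: e; rewrite x0 !expr0n !mulr0 !add0r => e.
  by rewrite -sqrf_eq0 -e; apply/eqP; ring.
have n4 : 4 != 0 :> Qn by apply: natr_neq0.
(* the inverse of the parametrisation: u - 1 = (8 - w) / 4c *)
apply: (@no_cyclotomic_cubic_root (1 + (8 - w) / (4 * x))) => //.
apply/eqP; rewrite -subr_eq0; apply/eqP.
have -> : (1 + (8 - w) / (4 * x)) ^+ 3 - (1 + (8 - w) / (4 * x)) ^+ 2 +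
    7 * (1 + (8 - w) / (4 * x)) + 1 - w =
    (8 - w) * (64 * x ^+ 3 + (128 * x ^+ 2 + (64 - 8 * w) * x +
      (w ^+ 2 - 16 * w + 64))) / (4 * x) ^+ 3 by field; rewrite x0 n4.
by rewrite e mulr0 mul0r.
Qed.

Lemma map_delta3_at (s : gal_of {:Qn}) x :
  map_poly s (delta3_at x) = delta3_at (s x).
Proof.
rewrite /delta3_at 3!rmorphD /= !map_polyZ !map_polyXn map_polyX map_polyC /=.
by rewrite !(rmorphXn, rmorph1, rmorph_nat, rmorphD, rmorphN, rmorphM).
Qed.

(** A root for the conjugate s(w) is carried by the inverse of s to a root for w, and a cubic
    without roots is irreducible. *)
Lemma delta3_at_irreducible (s : gal_of {:Qn}) : (1 < k)%N ->
  irreducible_poly (delta3_at (s w)).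
Proof.
move=> k1; apply: cubic_irreducible => [|x].
  by have [-> _] := size_delta3_at (s w) (natr_neq0 (isT : 0 < 64)%N).
apply/negP => rx; have := delta3_at_no_root ((s^-1)%g x) k1.
rewrite -(fmorph_root s) map_delta3_at /= -galM ?memvf // mulVg gal_id.
by rewrite rx.
Qed.

(** Irreducible polynomials that are not coprime are associate. Both leading coefficients are 64, so
    the cubics would agree, and the linear coefficient 64 - 8y determines the conjugate y. *)
Lemma delta3_at_coprime (s t : gal_of {:Qn}) : (1 < k)%N -> s != t ->
  coprimep (delta3_at (s w)) (delta3_at (t w)).
Proof.
move=> k1; apply: contraNT => nco.
have irs := delta3_at_irreducible s k1; have irt := delta3_at_irreducible t k1.
have n64 := natr_neq0 (isT : 0 < 64)%N.
move: nco; rewrite irreducible_poly_coprime // negbK => dv.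
have [sz _] := irs; have : delta3_at (s w) %= delta3_at (t w).
  by apply: apply_irredp => //; rewrite gtn_eqF.
case/eqpP => [[a b] /= /andP[a0 b0]] eab.
have [[_ ls] [_ lt]] := (size_delta3_at (s w) n64, size_delta3_at (t w) n64).
have := congr1 lead_coef eab; rewrite !lead_coefZ ls lt => /(mulIf n64) ab.
move: eab; rewrite ab => /(scalerI b0) /(congr1 (fun p : {poly Qn} => p`_1)).
have coef1 y : (delta3_at y)`_1 = 64 - 8 * y.
  rewrite /delta3_at 3!coefD 3!coefZ coefX !coefXn coefC /=.
  by rewrite !mulr0 !add0r mulr1 addr0.
rewrite !coef1 => /addrI/oppr_inj/(mulfI (natr_neq0 (isT : 0 < 8)%N)) st.
by apply/eqP/(gal_gen_inj).
Qed.

Lemma map_DeltaLt : map_poly (intr : int -> Qn) (DeltaLt (3 * k) 3) =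
  \prod_(s : gal_of {:Qn}) delta3_at (s w).
Proof.
rewrite /DeltaLt mulKn // delta3E map_Res; last 2 first.
- rewrite lead_coef_map_inj ?(monicP (Cyclotomic_monic k)) ?polyC1 ?rmorph1 ?oner_eq0 //.
  exact: polyC_inj.
- rewrite (monicP delta3_poly_monic) rmorph1 oner_eq0.
  by [].
rewrite map_poly_polyC (Cyclotomic_galE) rmorph_prod /=.
have -> : \prod_(s in G) map_poly polyC ('X - (s w)%:P) =
    \prod_(a <- [seq (s w)%:P | s : gal_of {:Qn}]) ('X - a%:P).
  rewrite big_image /=; apply: eq_big => [s|s _]; first by rewrite in_galQ.
  by rewrite map_polyXsubC.
rewrite Res_prod_XsubC big_image; apply: eq_bigr => s _.
exact: horner_map_delta3.
Qed.

(** A nonconstant rational factor is divisible by one of the cubics. Being Galois invariant it is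
    divisible by all of them, and these are pairwise coprime, so it is divisible by their
    product. *)
Lemma irreducible_DeltaLt : (1 < k)%N ->
  irreducible_poly (map_poly (intr : int -> rat) (DeltaLt (3 * k) 3)).
Proof.
move=> k1; set P := map_poly _ _.
have n64 := natr_neq0 (isT : 0 < 64)%N.
have DP : map_poly (in_alg Qn) P = \prod_(s : gal_of {:Qn}) delta3_at (s w).
  rewrite -map_DeltaLt -map_poly_comp; apply: eq_map_poly => a /=.
  by rewrite alg_num_field ratr_int.
have nz (s : gal_of {:Qn}) : delta3_at (s w) != 0.
  by rewrite -size_poly_eq0 (size_delta3_at _ n64).1.
have P0 : P != 0 by rewrite -(map_poly_eq0 (in_alg Qn)) DP; apply/prodf_neq0.
split=> [|q q1 qP].
  rewrite -(size_map_poly (in_alg Qn)).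
  pose o : gal_of {:Qn} := 1%g.
  apply: (@leq_trans (size (delta3_at (o w)))).
    by rewrite (size_delta3_at _ n64).1.
  apply: dvdp_leq; first by rewrite map_poly_eq0.
  by rewrite DP (bigD1 o) //= dvdp_mulr.
rewrite -(eqp_map (in_alg Qn)) /eqp !dvdp_map qP /= -(dvdp_map (in_alg Qn)) DP.
have fix_q (s : gal_of {:Qn}) : map_poly s (map_poly (in_alg Qn) q) = map_poly (in_alg Qn) q.
  rewrite -map_poly_comp; apply: eq_map_poly => a /=.
  by rewrite linearZ /= rmorph1.
have [s dv_s] : exists s : gal_of {:Qn}, delta3_at (s w) %| map_poly (in_alg Qn) q.
  have [/existsP//|/existsPn no] := boolP [exists s : gal_of {:Qn},
      delta3_at (s w) %| map_poly (in_alg Qn) q].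
  case/eqP: q1; rewrite -(size_map_poly (in_alg Qn)); apply/eqP.
  rewrite -coprimepp; apply: (@coprimep_dvdr _ (map_poly (in_alg Qn) P)).
    by rewrite dvdp_map.
  rewrite coprimep_sym DP; apply: coprimep_prod => t; rewrite coprimep_sym.
  by rewrite irreducible_poly_coprime ?no //; apply: delta3_at_irreducible.
apply: prod_coprime_dvdp; first exact: index_enum_uniq.
  by move=> t t' tt'; apply: delta3_at_coprime.
move=> t; pose u : gal_of {:Qn} := (s^-1 * t)%g.
have := dv_s; rewrite -(dvdp_map u) fix_q map_delta3_at.
by rewrite /= -galM ?memvf // /u mulgA mulgV mul1g.
Qed.

End CyclotomicField.

(** * The case k = 1 *)

Lemma prim_root3 (z : algC) : 3.-primitive_root z -> z ^+ 2 = - z - 1.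
Proof.
move=> prim_z; apply/eqP; rewrite -subr_eq0; apply/eqP.
have z1 : z - 1 != 0.
  by rewrite subr_eq0 -[z]expr1 -(prim_order_dvd prim_z).
apply: (mulfI z1); transitivity (z ^+ 3 - 1); first by ring.
by rewrite (prim_expr_order prim_z) subrr mulr0.
Qed.

Lemma DeltaLt31E : DeltaLt 3 1 = 16 * 'X^2 + 4 * 'X + 7.
Proof.
rewrite /DeltaLt delta1E; apply: (map_inj_poly (@intr_inj algC)) => //.
have [z prim_z] := C_prim_root_exists (isT : 0 < 3)%N.
have Phi3 : map_poly (intr : int -> algC) 'Phi_3 = \prod_(a <- [:: z; z ^+ 2]) ('X - a%:P).
  rewrite (Cintr_Cyclotomic prim_z) /cyclotomic big_mkcond /=.
  by rewrite !big_ord_recl big_ord0 /= !big_cons big_nil /= mul1r expr1.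
rewrite map_Res; last 2 first.
- rewrite lead_coef_map_inj ?(monicP (Cyclotomic_monic _)) ?polyC1 ?rmorph1 ?oner_eq0 //.
  exact: polyC_inj.
- by rewrite (monicP delta1_poly_monic) rmorph1 oner_eq0.
rewrite map_poly_polyC.
have -> : map_poly polyC (map_poly (intr : int -> algC) 'Phi_3) =
    \prod_(a <- [:: z%:P; z%:P ^+ 2]) ('X - a%:P).
  by rewrite Phi3 !big_cons !big_nil !mulr1 rmorphM /= !map_polyXsubC -polyC_exp.
rewrite Res_prod_XsubC !big_cons big_nil mulr1.
have -> : map_poly (map_poly (intr : int -> algC)) delta1_poly =
    'X ^+ 2 - 2 * 'X + 4 * ('X)%:P.
  rewrite /delta1_poly /cpar.
  rewrite !(rmorphXn, rmorph1, rmorph_nat, rmorphD, rmorphN, rmorphM) /=.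
  by rewrite map_polyX !map_polyC /= map_polyX.
have c n y : (n%:R : {poly {poly algC}}).[y] = n%:R by rewrite -polyC_natr hornerC.
rewrite !(hornerD, hornerN, hornerM, horner_exp, hornerX, hornerC, c).
have e2 : z%:P ^+ 2 = - z%:P - 1 :> {poly algC}.
  by rewrite -polyC_exp (prim_root3 prim_z) polyCB polyCN.
rewrite e2 !(rmorphXn, rmorph1, rmorph_nat, rmorphD, rmorphN, rmorphM) /= map_polyX.
have q0 : z%:P ^+ 2 + z%:P + 1 = 0 :> {poly algC} by rewrite e2; ring.
(* The cofactor is the quotient of the difference of the two sides by z^2 + z + 1. *)
rewrite -[RHS]addr0 -[X in _ = _ + X](mul0r (z%:P ^+ 2 + z%:P + 8 * 'X - 7)) -q0.
by ring.
Qed.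

(** The only proper divisor of 3 is 1, and delta_3(1, c) is 4c + 7 times [DeltaLt 3 1]; cancelling
    determines the choice made by [epsilon]. *)
Lemma Delta33E : Delta 3 3 = 4 * 'X + 7.
Proof.
have H D : is_Delta_nn 3 D <-> D * (16 * 'X^2 + 4 * 'X + 7) =
    (4 * 'X + 7) * (16 * 'X^2 + 4 * 'X + 7).
  rewrite /is_Delta_nn (_ : divisors 3 = [:: 1%N; 3]) // !big_cons big_nil /=.
  rewrite mulr1 DeltaLt31E delta3E.
  have -> : delta3_poly.[1] = (4 * 'X + 7) * (16 * 'X^2 + 4 * 'X + 7).
    have c n : (n%:R : Zcx).[1] = n%:R by rewrite -polyC_natr hornerC.
    rewrite /delta3_poly /cpar.
    rewrite !(hornerD, hornerN, hornerM, horner_exp, hornerX, hornerC, c).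
    by ring.
  by split=> ->.
rewrite /Delta /=.
have /H : is_Delta_nn 3 (epsilon (inhabits 0) (is_Delta_nn 3)).
  by apply: epsilon_spec; exists (4 * 'X + 7); apply/H.
(* The cancelled factor is nonzero, since its value at 0 is 7. *)
apply: mulIf; apply/eqP => /(congr1 (fun p : {poly int} => p.[0])).
have c n : (n%:R : {poly int}).[0] = n%:R by rewrite -polyC_natr hornerC.
by rewrite 2!hornerD hornerM hornerXn !c hornerM hornerX c horner0 expr0n !mulr0.
Qed.

Theorem theorem1p2 (k : nat) :
  (0 < k)%N ->
  irreducible_poly (map_poly (fun a : int => (a%:~R : rat)) (Delta (3 * k) 3)).
Proof.
case: k => [//|[|k]] _.
  rewrite muln1 Delta33E; apply: irreducible_size2.
  rewrite -[7]polyC_natr -[4]polyC_natr mul_polyC.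
  rewrite rmorphD /= map_polyZ map_polyX map_polyC /=.
  rewrite size_polyDl size_scale ?size_polyX //.
  by rewrite size_polyC; case: (_ != 0).
rewrite /Delta (_ : (3 < 3 * k.+2)%N); last by lia.
(* The group enters through its order: the field obtained is generated by a primitive root of unity
   of that order. *)
have [Qn galQn [QnC autQn [w [prim_w gen_w] _]]] :=
  group_num_field_exists [set: 'Z_k.+2]%G.
rewrite cardsT card_ord in prim_w.
exact: (irreducible_DeltaLt galQn autQn prim_w gen_w).
Qed.
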